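(* Let $I$ be a right ideal in $\mathbb{H}[q_1,q_2]$. Then $\mathcal{J}(\mathcal{V}(I))=\mathcal{J}(\mathcal{V}_c(I))$; thus $$\mathcal{J}(\mathcal{V}(I))=\{P\in\mathbb{H}[q_1,q_2] : P(q_1,q_2)=0 \text{ for all } (q_1,q_2)\in\mathcal{V}(I)\}.$$
   Context: $\mathbb{H}$ denotes the skew field of quaternions, $\mathbb{S}=\{q\in\mathbb{H}: q^2=-1\}$, and $\mathbb{C}_J=\mathbb{R}+\mathbb{R}J$ for $J\in\mathbb{S}$. $\mathbb{H}[q_1,q_2]$ is the set of (slice) regular polynomials in two quaternionic variables, i.e. functions $P:\mathbb{H}^2\to\mathbb{H}$ of the form $P(q_1,q_2)=\sum_{n,m}q_1^nq_2^m a_{n,m}$ (finite sum, $a_{n,m}\in\mathbb{H}$ on the right, evaluated in exactly this order at arbitrary points of $\mathbb{H}^2$), a ring under $+$ and the $*$-product, the biadditive extension of $(q_1^nq_2^ma)*(q_1^rq_2^sb)=q_1^{n+r}q_2^{m+s}ab$. A right ideal is a subset $I$ closed under addition with $Q*P\in I$ for all $Q\in I$, $P\in\mathbb{H}[q_1,q_2]$. For a right ideal $I$, $\mathcal{V}(I)=\{(a,b)\in\mathbb{H}^2 : P(a,b)=0\text{ for all }P\in I\}$ and $\mathcal{V}_c(I)=\mathcal{V}(I)\cap\bigcup_{J\in\mathbb{S}}(\mathbb{C}_J)^2$. For $Z\subseteq\mathbb{H}^2$, $\mathcal{J}(Z)$ is the right ideal generated by the polynomials vanishing on $Z$: $\mathcal{J}(Z)=\{\sum_{k=1}^N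 P_k*Q_k : N\ge1,\ P_k,Q_k\in\mathbb{H}[q_1,q_2],\ P_k|_Z\equiv0\}$ (for $Z=\varnothing$ this is the whole ring). *)

(* Defs.v *)
From HB Require Import structures.
From mathcomp Require Import all_boot all_order all_algebra.
From mathcomp Require Import boolp classical_sets reals.
From mathcomp Require Import ring.

Set Implicit Arguments.
Unset Strict Implicit.
Unset Printing Implicit Defensive.

Import GRing.Theory.

Local Open Scope classical_set_scope.
Local Open Scope ring_scope.

(* [Quat a b c d] stands for a + b i + c j + d k. *)
Record quat (R : realType) : Type :=
  Quat { qre : R; qi : R; qj : R; qk : R }.

Section QuatRing.
Variable R : realType.
Implicit Types p q r : quat R.

Definition quat_tuple q : R * R * R * R := (qre q, qi q, qj q, qk q).
Definition tuple_quat (t : R * R * R * R) : quat R :=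
  let: (a, b, c, d) := t in Quat a b c d.

Lemma quat_tupleK : cancel quat_tuple tuple_quat.
Proof. by case. Qed.

HB.instance Definition _ := Choice.copy (quat R) (can_type quat_tupleK).

Definition addq p q : quat R :=
  Quat (qre p + qre q) (qi p + qi q) (qj p + qj q) (qk p + qk q).
Definition oppq q : quat R := Quat (- qre q) (- qi q) (- qj q) (- qk q).

Lemma addqA : associative addq.
Proof. by move=> p q r; rewrite /addq /= !addrA. Qed.
Lemma addqC : commutative addq.
Proof. by move=> p q; congr Quat; apply: addrC. Qed.
Lemma add0q : left_id (Quat 0 0 0 0) addq.
Proof. by case=> a b c d; rewrite /addq /= !add0r. Qed.
Lemma addNq : left_inverse (Quat 0 0 0 0) oppq addq.
Proof. by move=> p; rewrite /addq /= !addNr. Qed.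

HB.instance Definition _ := GRing.isZmodule.Build (quat R) addqA addqC add0q addNq.

(* i^2 = j^2 = k^2 = ijk = -1 *)
Definition mulq p q : quat R :=
  Quat (qre p * qre q - qi p * qi q - qj p * qj q - qk p * qk q)
       (qre p * qi q + qi p * qre q + qj p * qk q - qk p * qj q)
       (qre p * qj q - qi p * qk q + qj p * qre q + qk p * qi q)
       (qre p * qk q + qi p * qj q - qj p * qi q + qk p * qre q).

Lemma mulqA : associative mulq.
Proof. by move=> p q r; congr Quat => /=; ring. Qed.
Lemma mul1q : left_id (Quat 1 0 0 0) mulq.
Proof. by case=> a b c d; congr Quat => /=; ring. Qed.
Lemma mulq1 : right_id (Quat 1 0 0 0) mulq.
Proof. by case=> a b c d; congr Quat => /=; ring. Qed.
Lemma mulqDl : left_distributive mulq addq.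
Proof. by move=> p q r; congr Quat => /=; ring. Qed.
Lemma mulqDr : right_distributive mulq addq.
Proof. by move=> p q r; congr Quat => /=; ring. Qed.
Lemma oneq_neq0 : Quat 1 0 0 0 != 0 :> quat R.
Proof. by apply/eqP => -[] /eqP; rewrite oner_eq0. Qed.

HB.instance Definition _ := GRing.Zmodule_isNzRing.Build (quat R)
  mulqA mul1q mulq1 mulqDl mulqDr oneq_neq0.

Definition qreal (x : R) : quat R := Quat x 0 0 0.

End QuatRing.

(* H[q1,q2]: the polynomial P stands for the function
   (q1, q2) |-> \sum_(n, m) q1 ^+ n * q2 ^+ m * P`_n`_m (see [peval]), so the
   outer variable is q1 and the inner one is q2.  The library's product on
   {poly {poly _}} lets both variables commute with each other and with the
   coefficients, without commuting coefficients: it is the *-product.  A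
   polynomial function determines its coefficients (already by its values at
   real points), so formal polynomials and polynomial functions are the same
   objects; but [peval] is not multiplicative. *)
Notation hpoly R := {poly {poly (quat R)}}.

Section Zeros.
Variable R : realType.
Local Notation H := (quat R).

(* Not [horner], which puts coefficients to the left of the powers. *)
Definition peval (P : hpoly R) (z : H * H) : H :=
  \sum_(n < size P) \sum_(m < size P`_n) z.1 ^+ n * z.2 ^+ m * P`_n`_m.

(* Nonemptiness is not required; the empty set has the same zeros as {0}. *)
Definition right_ideal (I : set (hpoly R)) : Prop :=
  (forall P Q, I P -> I Q -> I (P + Q)) /\
  (forall Q P, I Q -> I (Q * P)).

Definition imag_units : set H := [set q | q ^+ 2 = -1].

Definition slice (J : H) : set H :=
  [set q | exists x y : R, q = qreal x + qreal y * J].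

Definition zeros (I : set (hpoly R)) : set (H * H) :=
  [set z | forall P, I P -> peval P z = 0].

Definition zeros_c (I : set (hpoly R)) : set (H * H) :=
  zeros I `&` \bigcup_(J in imag_units) (slice J `*` slice J).

Definition vanishes_on (Z : set (H * H)) (P : hpoly R) : Prop :=
  forall z, Z z -> peval P z = 0.

Definition vanishing_ideal (Z : set (H * H)) : set (hpoly R) :=
  [set F | exists (N : nat) (P Q : 'I_N -> hpoly R),
    [/\ (0 < N)%N,
        forall k, vanishes_on Z (P k)
      & F = \sum_(k < N) P k * Q k]].

End Zeros.

(* Main.v *)
Require Import Defs.
From mathcomp Require Import all_boot all_order all_algebra.
From mathcomp Require Import boolp classical_sets reals.
From mathcomp Require Import ring lra.

Import Order.TTheory GRing.Theory Num.Theory.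

Local Open Scope classical_set_scope.
Local Open Scope ring_scope.

(** The inclusion that needs an argument is that a polynomial [P] vanishing on
    [zeros_c I] vanishes on all of [zeros I].

    At a point [(a, b)] with [a * b = b * a], evaluation is compatible with
    the product of polynomials on the right: the monomials of the right factor
    can be moved to the far left, so [P * Q] vanishes there as soon as [P] does
    ([peval_mul_comm_eq0]).  Points of [zeros_c I] are of this kind, hence every
    element of [vanishing_ideal (zeros_c I)] vanishes on [zeros_c I].

    Now let [(a, b)] be a zero of [I] with [a] and [b] not commuting.  Since [a]
    satisfies a real quadratic equation, its powers are [x + a * y] with real
    [x] and [y] depending only on the trace and the norm of [a], that is, on the
    sphere [S] of conjugates of [a].  Therefore [Q(a, b) = A + a * B] with [A]
    and [B] constant along [S], and the product of [Q] with the second variable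
    has value [b * A + a * (b * B)] ([peval_sphere]).  When [Q] is in [I], so
    is that product; both values vanish, and eliminating [A] gives
    [(a * b - b * a) * B = 0], so [B = A = 0]: the whole of [S * {b}] consists
    of zeros of [I] ([zeros_sphere]).

    The sphere [S] meets the slice of [b] in two distinct points, and there
    [P] vanishes.  As [P] too has the form [A + a' * B] for [a'] on [S], two
    distinct zeros force [A = B = 0], and [P(a, b) = 0]
    ([vanishes_on_zeros]). *)

(** * Quaternions, slices and spheres *)

Section Quaternions.
Set Implicit Arguments.
Unset Strict Implicit.
Variable R : realType.
Local Notation H := (quat R).
Implicit Types (p q a b J : H) (x y : R).

Lemma quatP p q :
  qre p = qre q -> qi p = qi q -> qj p = qj q -> qk p = qk q -> p = q.
Proof. by case: p => ????; case: q => ???? /= -> -> -> ->. Qed.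

(* The operations are qualified because the rational numbers have homonyms. *)
Lemma quatME p q : p * q = Defs.mulq p q. Proof. by []. Qed.
Lemma quatDE p q : p + q = Defs.addq p q. Proof. by []. Qed.
Lemma quatNE p : - p = Defs.oppq p. Proof. by []. Qed.
Lemma quat0E : 0 = Quat 0 0 0 0 :> H. Proof. by []. Qed.
Lemma quat1E : 1 = Quat 1 0 0 0 :> H. Proof. by []. Qed.
Definition quatE := (quatME, quatDE, quatNE, quat0E, quat1E).

Lemma qreal_comm x q : qreal x * q = q * qreal x.
Proof. by apply: quatP; rewrite !quatE /=; ring. Qed.

Definition qnorm q : R := qre q ^+ 2 + qi q ^+ 2 + qj q ^+ 2 + qk q ^+ 2.

Definition qconj q : H := Quat (qre q) (- qi q) (- qj q) (- qk q).

Lemma mul_qconj q : qconj q * q = qreal (qnorm q).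
Proof. by apply: quatP; rewrite !quatE /qnorm /=; ring. Qed.

Lemma qnorm_eq0 q : qnorm q = 0 -> q = 0.
Proof. by rewrite /qnorm => h; apply: quatP => /=; nra. Qed.

Lemma quat_integral p q : p * q = 0 -> p <> 0 -> q = 0.
Proof.
move=> pq0 p0; have /eqP n0 : qnorm p <> 0 by move/qnorm_eq0.
have : qconj p * (p * q) = 0 by rewrite pq0 mulr0.
rewrite mulrA mul_qconj => h.
suff -> : q = qreal (qnorm p)^-1 * (qreal (qnorm p) * q) by rewrite h mulr0.
by apply: quatP; rewrite !quatE /=; field.
Qed.

Definition unit_im J := qre J = 0 /\ qi J ^+ 2 + qj J ^+ 2 + qk J ^+ 2 = 1.

Lemma unit_im_imag_units J : unit_im J -> imag_units J.
Proof.
case=> J0 J1; rewrite /imag_units /= expr2.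
apply: quatP; rewrite !quatE /= !J0; try ring.
by rewrite -J1; ring.
Qed.

Definition im_norm q : R := Num.sqrt (qi q ^+ 2 + qj q ^+ 2 + qk q ^+ 2).

Lemma im_norm_sqr q : im_norm q ^+ 2 = qi q ^+ 2 + qj q ^+ 2 + qk q ^+ 2.
Proof. by rewrite sqr_sqrtr // !addr_ge0 ?sqr_ge0. Qed.

Lemma im_norm_eq0 q : im_norm q = 0 -> q = qreal (qre q).
Proof.
move=> h; have := im_norm_sqr q; rewrite h => h'.
by apply: quatP => //=; nra.
Qed.

Lemma slice_real J x : slice J (qreal x).
Proof. by exists x, 0; apply: quatP; rewrite !quatE /=; ring. Qed.

Lemma slice_exists q : exists2 J, unit_im J & slice J q.
Proof.
have [/im_norm_eq0 -> | n0] := eqVneq (im_norm q) 0.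
  exists (Quat 0 1 0 0); last exact: slice_real.
  by split=> //=; ring.
set s := im_norm q.
exists (Quat 0 (qi q / s) (qj q / s) (qk q / s)).
  split=> //=; rewrite !exprMn -!mulrDl -im_norm_sqr exprVn mulfV //.
  by rewrite expf_neq0.
by exists (qre q), s; apply: quatP; rewrite !quatE /=; field.
Qed.

(** Commuting with [b] means commuting with [J]; the imaginary part of [a] is
    then parallel to [J], because their cross product is zero. *)
Lemma centralizer_slice J a b : unit_im J -> slice J b ->
  b <> qreal (qre b) -> a * b = b * a -> slice J a.
Proof.
case=> J0 J1 [x [y eb]] nb; have y0 : y != 0.
  by apply/eqP => y0; apply: nb; rewrite eb y0; apply: quatP;
    rewrite !quatE /= ?J0; ring.
move=> ab; have hJ : qreal y * (a * J) = qreal y * (J * a).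
  have : a * (qreal x + qreal y * J) = (qreal x + qreal y * J) * a.
    by rewrite -eb.
  rewrite mulrDr mulrDl (qreal_comm x a) => /addrI.
  by rewrite mulrA -(qreal_comm y a) -!mulrA.
have {}hJ : a * J = J * a.
  apply/eqP; rewrite -subr_eq0; apply/eqP; apply: (@quat_integral (qreal y)).
    by rewrite mulrBr hJ subrr.
  by case=> /eqP; rewrite (negPf y0).
(* The second coordinate is the scalar product of the imaginary parts. *)
exists (qre a), (qi a * qi J + qj a * qj J + qk a * qk J).
(* The imaginary components of [a * J = J * a] give [e1], [e2], [e3]. *)
case: hJ; case: J J0 J1 {eb} => J_ Ji Jj Jk /= -> J1 _ hi hj hk.
have e1 : qj a * Jk = qk a * Jj by lra.
have e2 : qk a * Ji = qi a * Jk by lra.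
have e3 : qi a * Jj = qj a * Ji by lra.
have mulJ (u v w : R) : u = v -> u * w = v * w by move->.
have [e1j e1k] := (mulJ _ _ Jj e1, mulJ _ _ Jk e1).
have [e2i e2k] := (mulJ _ _ Ji e2, mulJ _ _ Jk e2).
have [e3i e3j] := (mulJ _ _ Ji e3, mulJ _ _ Jj e3).
have J1a u : u * (Ji ^+ 2 + Jj ^+ 2 + Jk ^+ 2) = u by rewrite J1 mulr1.
have [[J1i J1j] J1k] := (J1a (qi a), J1a (qj a), J1a (qk a)).
by apply: quatP; rewrite !quatE /=; lra.
Qed.

(** When [t ^+ 2 < 4 * n] this is the sphere of quaternions of trace [t] and
    norm [n]; the quadratic equation is the only property of the sphere that
    reduces powers of its points. *)
Definition on_sphere (t n : R) a := a * a = a * qreal t - qreal n.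

Lemma on_sphere_self a : on_sphere (qre a *+ 2) (qnorm a) a.
Proof. by apply: quatP; rewrite !quatE /qnorm /=; ring. Qed.

Lemma on_sphere_slice a J s : unit_im J -> s ^+ 2 = im_norm a ^+ 2 ->
  on_sphere (qre a *+ 2) (qnorm a) (qreal (qre a) + qreal s * J).
Proof.
case; case: J => J_ Ji Jj Jk /= -> J1; rewrite im_norm_sqr => hs.
have -> : qnorm a = qre a ^+ 2 + s ^+ 2 by rewrite hs /qnorm; ring.
have {}J1 : s ^+ 2 * (Ji ^+ 2 + Jj ^+ 2 + Jk ^+ 2) = s ^+ 2 by rewrite J1 mulr1.
by apply: quatP; rewrite !quatE /=; lra.
Qed.

End Quaternions.

(** * Evaluation at points of H^2 *)

Section Evaluation.
Set Implicit Arguments.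
Unset Strict Implicit.
Variable R : realType.
Local Notation H := (quat R).
Implicit Types (p q : {poly H}) (P Q : hpoly R) (a b c : H) (z : H * H).

(** Evaluation with the powers of [b] to the left of the coefficients, the
    one-variable analogue of [peval]. *)
Definition lhorner b p : H := \sum_(m < size p) b ^+ m * p`_m.

Lemma lhornerE b p N : (size p <= N)%N ->
  lhorner b p = \sum_(m < N) b ^+ m * p`_m.
Proof.
move=> h; rewrite /lhorner.
rewrite (big_ord_widen N (fun m => b ^+ m * p`_m) h).
rewrite big_mkcond /=.
apply: eq_bigr => m _; case: ltnP => // /(nth_default 0) ->.
by rewrite mulr0.
Qed.

Lemma lhornerD b p q : lhorner b (p + q) = lhorner b p + lhorner b q.
Proof.
have hp := leq_maxl (size p) (size q); have hq := leq_maxr (size p) (size q).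
rewrite (lhornerE _ (size_polyD p q)) (lhornerE _ hp) (lhornerE _ hq).
by rewrite -big_split; apply: eq_bigr => m _; rewrite coefD mulrDr.
Qed.

Lemma lhorner0 b : lhorner b 0 = 0.
Proof. by rewrite /lhorner size_poly0 big_ord0. Qed.

Lemma lhornerMX b p : lhorner b (p * 'X) = b * lhorner b p.
Proof.
rewrite (@lhornerE _ (p * 'X) (size p).+1); last first.
  by rewrite (leq_trans (size_polyMleq _ _)) // size_polyX addn2.
rewrite big_ord_recl coefMX mulr0 add0r /lhorner big_distrr /=.
by apply: eq_bigr => m _; rewrite coefMX /= exprS mulrA.
Qed.

Lemma lhornerMC b p c : lhorner b (p * c%:P) = lhorner b p * c.
Proof.
rewrite (@lhornerE _ (p * c%:P) (size p)); last first.
  rewrite (leq_trans (size_polyMleq _ _)) //.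
  by have := size_polyC_leq1 c; case: (size c%:P) => [|[|]] // _;
    rewrite ?addn0 ?addn1 ?leq_pred.
by rewrite big_distrl; apply: eq_bigr => m _; rewrite coefMC mulrA.
Qed.

Lemma pevalE P z N : (size P <= N)%N ->
  peval P z = \sum_(n < N) z.1 ^+ n * lhorner z.2 P`_n.
Proof.
move=> h; have -> : peval P z = \sum_(n < size P) z.1 ^+ n * lhorner z.2 P`_n.
  apply: eq_bigr => n _; rewrite /lhorner big_distrr /=.
  by apply: eq_bigr => m _; rewrite mulrA.
rewrite (big_ord_widen N (fun n => z.1 ^+ n * lhorner z.2 P`_n) h).
rewrite big_mkcond /=.
apply: eq_bigr => n _; case: ltnP => // /(nth_default 0) ->.
by rewrite lhorner0 mulr0.
Qed.

Lemma pevalD P Q z : peval (P + Q) z = peval P z + peval Q z.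
Proof.
have hp := leq_maxl (size P) (size Q); have hq := leq_maxr (size P) (size Q).
rewrite (pevalE _ (size_polyD P Q)) (pevalE _ hp) (pevalE _ hq).
by rewrite -big_split; apply: eq_bigr => m _; rewrite coefD lhornerD mulrDr.
Qed.

Lemma peval0 z : peval 0 z = 0.
Proof. by rewrite /peval size_poly0 big_ord0. Qed.

Lemma pevalC p z : peval p%:P z = lhorner z.2 p.
Proof.
by rewrite (pevalE _ (size_polyC_leq1 p)) big_ord1 coefC eqxx mul1r.
Qed.

Lemma pevalMX P z : peval (P * 'X) z = z.1 * peval P z.
Proof.
rewrite (@pevalE (P * 'X) _ (size P).+1); last first.
  by rewrite (leq_trans (size_polyMleq _ _)) // size_polyX addn2.
rewrite big_ord_recl coefMX lhorner0 mulr0 add0r.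
rewrite (pevalE z (leqnn _)) big_distrr /=.
by apply: eq_bigr => m _; rewrite coefMX /= exprS mulrA.
Qed.

Lemma pevalMC P z c : peval (P * c%:P%:P) z = peval P z * c.
Proof.
elim/poly_ind: P => [|P p IH]; first by rewrite mul0r peval0 mul0r.
rewrite mulrDl -mulrA -commr_polyX mulrA !pevalD !pevalMX IH -polyCM !pevalC.
by rewrite lhornerMC mulrDl mulrA.
Qed.

(** The constants [A] and [B] depend on the sphere and on [b], not on the point
    of the sphere.  The second equation uses the same [A] and [B] because the
    powers of [a] reduce to real combinations of [1] and [a], and real numbers
    commute with the additional factor [b]. *)
Lemma peval_sphere P b t n : exists A B, forall a, on_sphere t n a ->
  peval P (a, b) = A + a * B /\
  peval (P * 'X%:P) (a, b) = b * A + a * (b * B).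
Proof.
elim/poly_ind: P => [|P p [A [B IH]]].
  by exists 0, 0 => a _; rewrite mul0r peval0 !mulr0 addr0.
exists (lhorner b p - qreal n * B), (A + qreal t * B) => a ha.
have [e1 e2] := IH a ha.
have sq C : a * (a * C) = a * (qreal t * C) - qreal n * C.
  by rewrite mulrA ha mulrBl !mulrA.
have comm x C : qreal x * (b * C) = b * (qreal x * C).
  by rewrite !mulrA qreal_comm.
split.
  rewrite pevalD pevalMX e1 pevalC /= !mulrDr sq.
  by rewrite [RHS]addrC -!addrA; congr (_ + (_ + _)); rewrite addrC.
rewrite mulrDl -mulrA -commr_polyX mulrA -polyCM pevalD pevalMX e2 pevalC /=.
rewrite lhornerMX !mulrDr sq !comm mulrN.
by rewrite [RHS]addrC -!addrA; congr (_ + (_ + _)); rewrite addrC.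
Qed.

(** For noncommuting [a] and [b] this fails, since the new factor [b] stands
    between the powers of [a] and those of [b]. *)
Lemma pevalMX2_comm P a b : a * b = b * a ->
  peval (P * 'X%:P) (a, b) = b * peval P (a, b).
Proof.
move=> ab; have [A [B h]] := peval_sphere P b (qre a *+ 2) (qnorm a).
have [-> ->] := h a (on_sphere_self a).
by rewrite mulrDr !mulrA ab.
Qed.

(** Multiplying on the right by a variable or by a constant preserves the
    vanishing at a commuting point, and [Q] is built from these by sums. *)
Lemma peval_mul_comm_eq0 P Q a b : a * b = b * a ->
  peval P (a, b) = 0 -> peval (P * Q) (a, b) = 0.
Proof.
move=> ab P0; elim/poly_ind: Q => [|Q q IHQ]; first by rewrite mulr0 peval0.
rewrite mulrDr mulrA pevalD pevalMX IHQ mulr0 add0r.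
elim/poly_ind: q => [|q c IHq]; first by rewrite mulr0 peval0.
rewrite polyCD mulrDr pevalD polyCM mulrA pevalMX2_comm // IHq mulr0 add0r.
by rewrite pevalMC P0 mul0r.
Qed.

(** * Zeros of right ideals *)

Lemma slice_comm J a b : slice J a -> slice J b -> a * b = b * a.
Proof.
move=> [x [y ->]] [x' [y' ->]].
by apply: quatP; rewrite !quatE /=; ring.
Qed.

(** Both [Q] and its product with the second variable lie in [I]; the two
    resulting linear equations in the sphere constants of [Q] have
    [a * b - b * a] as determinant. *)
Lemma zeros_sphere (I : set (hpoly R)) a b a' : right_ideal I ->
  zeros I (a, b) -> a * b <> b * a -> on_sphere (qre a *+ 2) (qnorm a) a' ->
  zeros I (a', b).
Proof.
move=> [_ IM] zab nab ha' Q IQ.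
have [A [B h]] := peval_sphere Q b (qre a *+ 2) (qnorm a).
have [e1 e2] := h a (on_sphere_self a).
rewrite (zab _ IQ) in e1; rewrite (zab _ (IM _ _ IQ)) in e2.
have eA : A = - (a * B) by apply/eqP; rewrite -addr_eq0 -e1.
have B0 : B = 0.
  apply: (@quat_integral _ (a * b - b * a)); last by move/subr0_eq.
  by rewrite mulrBl e2 eA mulrN addrC !mulrA.
have [-> _] := h a' ha'.
by rewrite eA B0 !mulr0 oppr0 addr0.
Qed.

(** A noncommuting zero [(a, b)] is reached from two commuting ones, the points
    where the sphere of [a] meets the slice of [b]. *)
Lemma vanishes_on_zeros (I : set (hpoly R)) P : right_ideal I ->
  vanishes_on (zeros_c I) P -> vanishes_on (zeros I) P.
Proof.
move=> hI hP [a b] zab.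
have in_c J a' : unit_im J -> slice J a' -> slice J b -> zeros I (a', b) ->
    peval P (a', b) = 0.
  move=> uJ Ja Jb z'; apply: hP; split=> //.
  by exists J; [exact: unit_im_imag_units|].
(* A real [b] lies in every slice, so the slice must be chosen from [a]. *)
have [breal|bnreal] := EM (b = qreal (qre b)).
  have [J uJ Ja] := slice_exists a.
  by apply: (in_c J) => //; rewrite breal; apply: slice_real.
have [J uJ Jb] := slice_exists b.
have [Ja|nJa] := EM (slice J a); first exact: (in_c J).
have nab : a * b <> b * a by move/(centralizer_slice uJ Jb bnreal).
pose s := im_norm a.
have s0 : s <> 0.
  by move=> /im_norm_eq0 ea; apply: nJa; rewrite ea; exact: slice_real.
(* For [x = s] and [x = - s] these are the points of the sphere of [a] in the
   slice of [b]. *)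
pose a' x := qreal (qre a) + qreal x * J.
have [A [B h]] := peval_sphere P b (qre a *+ 2) (qnorm a).
have AB x : x ^+ 2 = s ^+ 2 -> A + a' x * B = 0.
  move=> xs; have ha' := on_sphere_slice uJ xs.
  have [<- _] := h _ ha'.
  apply: (in_c J) => //; first by exists (qre a), x.
  exact: (zeros_sphere hI zab).
have B0 : B = 0.
  (* The difference of the two equations is [(a' s - a' (- s)) * B = 0]. *)
  apply: (@quat_integral _ (a' s - a' (- s))).
    have e := AB s erefl; have := AB (- s) (sqrrN s).
    rewrite -e => /addrI e'.
    by rewrite mulrBl e' subrr.
  move/subr0_eq/addrI => e; apply: s0.
  case: uJ => J0 J1; case: e => _ e1 e2 e3; nra.
have A0 : A = 0 by rewrite -(AB s erefl) B0 mulr0 addr0.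
have [-> _] := h a (on_sphere_self a).
by rewrite A0 B0 mulr0 addr0.
Qed.

End Evaluation.

Theorem theorem4p15 (R : realType) (I : set (hpoly R)) (hI : right_ideal I) :
  vanishing_ideal (zeros I) = vanishing_ideal (zeros_c I) /\
  vanishing_ideal (zeros I) =
    [set P : hpoly R | forall z : quat R * quat R, zeros I z -> peval P z = 0].
Proof.
have sub_c : vanishing_ideal (zeros I) `<=` vanishing_ideal (zeros_c I).
  move=> F [N [P [Q [N0 hP ->]]]]; exists N, P, Q; split=> // k z [zI _].
  exact: hP.
have c_sub : vanishing_ideal (zeros_c I) `<=` vanishes_on (zeros I).
  move=> F [N [P [Q [_ hP ->]]]]; apply: vanishes_on_zeros => // z zc.
  apply: (big_ind (fun G => peval G z = 0)) => [|G G' h h'|k _].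
  - exact: peval0.
  - by rewrite pevalD h h' addr0.
  have := hP k z zc; case: z zc => a b [_ [J _ [/= Ja Jb]]].
  exact/peval_mul_comm_eq0/(slice_comm Ja Jb).
have sub_v : vanishes_on (zeros I) `<=` vanishing_ideal (zeros I).
  move=> F hF; exists 1%N, (fun=> F), (fun=> 1); split=> //.
  by rewrite big_ord1 mulr1.
split; apply/seteqP; split=> // F.
- by move/c_sub/sub_v.
- by move/sub_c/c_sub.
Qed.
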